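(* Let $\lambda_0(A)$ be a nuclear $G_1$-space whose Köthe matrix $A=(a_n)_n$ satisfies $\lim_{i\to\infty}a_n(i)=0$ for all $n\in\mathbb{N}$, and let $\mathsf{C}:\lambda_0(A)\to\lambda_0(A)$ be the Cesàro operator. Then $\Sigma=\sigma(\mathsf{C};\lambda_0(A))$, where $\Sigma=\{\frac1k:k\in\mathbb{N}\}$.
   Context: $\mathbb{N}=\{1,2,3,\dots\}$. A Köthe matrix is $A=(a_n)_{n\in\mathbb{N}}$, $a_n=(a_n(i))_{i\in\mathbb{N}}$, with $0\le a_n(i)\le a_{n+1}(i)$ for all $i,n$, and such that for every $i$ there is $n$ with $a_n(i)>0$. The Köthe echelon space of order $0$ is $\lambda_0(A)=\{x\in\mathbb{C}^{\mathbb{N}}:\lim_{i\to\infty}a_n(i)x_i=0\ \forall n\in\mathbb{N}\}$, a Fréchet space with the seminorms $p_n(x)=\sup_{i}a_n(i)|x_i|$. It is called a $G_1$-space (smooth sequence space of finite type) if (G1-1) $0<a_n(i+1)\le a_n(i)$ for all $n,i\in\mathbb{N}$, and (G1-2) for all $n$ there exist $m>n$ and $C>0$ such that $a_n(i)\le C\,a_m(i)^2$ for all $i\in\mathbb{N}$. The Cesàro operator is $\mathsf{C}x=\left(\frac1i\sum_{j=1}^i x_j\right)_{i\in\mathbb{N}}$; it maps $\lambda_0(A)$ continuously into itself when (G1-1) holds. For a locally convex Hausdorff space $X$ let $\mathcal{L}(X)$ be the space of continuous linear operators on $X$. For $T\in\mathcal{L}(X)$ the resolvent set is the set of $\lambda\in\mathbb{C}$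 such that $(\lambda I-T)^{-1}$ exists in $\mathcal{L}(X)$; the spectrum $\sigma(T;X)$ is its complement in $\mathbb{C}$. *)

(* Defs.v *)
From HB Require Import structures.
From mathcomp Require Import all_boot all_order all_algebra.
From mathcomp Require Import complex.
From mathcomp Require Import all_classical all_reals all_analysis.

Set Implicit Arguments.
Unset Strict Implicit.
Unset Printing Implicit Defensive.

Import Order.TTheory GRing.Theory Num.Theory.
Import numFieldNormedType.Exports.

Local Open Scope classical_set_scope.
Local Open Scope ring_scope.
Local Open Scope complex_scope.

Section LocallyConvex.
Variable K : numFieldType.

Definition seminorm (E : lmodType K) (p : E -> K) : Prop :=
  (forall x y, p (x + y) <= p x + p y) /\
  (forall (c : K) x, p (c *: x) = `|c| * p x).

Definition continuous_seminorm (E : tvsType K) (p : E -> K) : Prop :=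
  seminorm p /\ continuous (p : E -> K^o).

Definition nuclear_map (X Y : normedModType K) (T : {linear X -> Y}) : Prop :=
  exists (c : nat -> K^o) (f : nat -> {scalar X}) (y : nat -> Y),
    [/\ cvgn (series (fun k => `|c k| : K^o)),
        forall k x, `|f k x| <= `|x|,
        forall k, `|y k| <= 1
      & forall x, series (fun k => (c k * f k x) *: y k) @ \oo --> T x].

(* [B], together with [i], is (up to a unique isometry) the completion of the
   normed space E / ker p. *)
Definition local_banach (E : tvsType K) (p : E -> K)
    (B : completeNormedModType K) (i : {linear E -> B}) : Prop :=
  (forall x, `|i x| = p x) /\ dense (range i).

(* [T] is the canonical map between the local Banach spaces of [q] and [p]:
   it is the continuous extension of [x + ker q |-> x + ker p]. *)
Definition nuclear_space (E : tvsType K) : Prop :=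
  forall p : E -> K, continuous_seminorm p ->
  exists q : E -> K, [/\ continuous_seminorm q, forall x, p x <= q x &
    exists (Ep Eq : completeNormedModType K)
           (ip : {linear E -> Ep}) (iq : {linear E -> Eq}),
      [/\ local_banach p ip, local_banach q iq &
        exists T : {linear Eq -> Ep},
          [/\ continuous T, forall x, T (iq x) = ip x & nuclear_map T]]].

Record continuous_operator (E : tvsType K) := ContinuousOperator {
  operator_fun :> {linear E -> E};
  operator_continuous : continuous operator_fun }.

Definition resolvent_set (E : tvsType K) (T : continuous_operator E) : set K :=
  [set l | exists S : continuous_operator E,
     (forall x, S (l *: x - T x) = x) /\ (forall x, l *: S x - T (S x) = x)].

Definition spectrum (E : tvsType K) (T : continuous_operator E) : set K :=
  ~` resolvent_set T.

End LocallyConvex.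

(* All sequences are indexed from 0: the index i : nat stands for i + 1. *)
Record kothe_matrix (R : realType) := KotheMatrix {
  kothe_fun :> nat -> nat -> R;
  kothe_ge0 : forall n i, 0 <= kothe_fun n i;
  kothe_mono : forall n i, kothe_fun n i <= kothe_fun n.+1 i;
  kothe_pos : forall i, exists n, 0 < kothe_fun n i }.

Section KotheEchelon.
Variables (R : realType) (A : kothe_matrix R).
Local Notation C := R[i].

Definition lambda0_set : set (nat -> C) :=
  [set x | forall n, (fun i => (A n i)%:C * x i : C^o) @ \oo --> (0 : C^o)].

Definition lambda0_pred : {pred nat -> C} := mem lambda0_set.

Record lambda0 := Lambda0 {
  lambda0_seq :> nat -> C;
  _ : lambda0_seq \in lambda0_pred }.

HB.instance Definition _ := [isSub for lambda0_seq].
HB.instance Definition _ := [Choice of lambda0 by <:].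

Let nrm (n : nat) (x : nat -> C) (i : nat) : R := A n i * Normc.normc (x i).

Let normCE (z : C) : `|z| = (Normc.normc z)%:C. Proof. by []. Qed.

Let normc_ge0 (z : C) : 0 <= Normc.normc z.
Proof. by case: z => a b /=; exact: sqrtr_ge0. Qed.

Let nrm_ge0 n x i : 0 <= nrm n x i.
Proof. by rewrite mulr_ge0 ?kothe_ge0. Qed.

Let cvg_nrm (n : nat) (x : nat -> C) :
  ((fun i => (A n i)%:C * x i : C^o) @ \oo --> (0 : C^o)) <->
  (nrm n x @ \oo --> (0 : R)).
Proof.
have E i : `|(A n i)%:C * x i| = (nrm n x i)%:C.
  rewrite normCE Normc.normcM; congr ((_ * _)%:C).
  by rewrite /= expr0n addr0 sqrtr_sqr ger0_norm// kothe_ge0.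
split.
- move=> /cvgrPdist_lt H; apply/cvgrPdist_lt => e e0.
  have e0' : (0 : C) < e%:C by rewrite ltcR.
  have := H _ e0'; apply: filterS => i.
  by rewrite !sub0r !normrN E ltcR ger0_norm.
- move=> /cvgrPdist_lt H; apply/cvgrPdist_lt => e e0.
  have [r er] := complex_realP _ (gtr0_real e0).
  have r0 : 0 < r by move: e0; rewrite er ltcR.
  have := H _ r0; apply: filterS => i.
  by rewrite !sub0r !normrN E er ltcR ger0_norm.
Qed.

Let lambda0P (x : nat -> C) :
  x \in lambda0_pred <-> forall n, nrm n x @ \oo --> (0 : R).
Proof.
split; first by move=> /set_mem H n; apply/cvg_nrm; exact: H.
by move=> H; apply/mem_set => n; apply/cvg_nrm; exact: H.
Qed.

Let nrmD n x y i : nrm n (x + y) i <= nrm n x i + nrm n y i.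
Proof. by rewrite /nrm -mulrDr ler_wpM2l ?kothe_ge0 ?le_normcD. Qed.

Let normc0 : Normc.normc (0 : C) = 0. Proof. exact: Normc.normc0. Qed.

Let nrmZ n c x i : nrm n (c *: x) i = Normc.normc c * nrm n x i.
Proof. by rewrite /nrm mulrCA -Normc.normcM. Qed.

Lemma lambda0_submod_closed : submod_closed lambda0_pred.
Proof.
split.
  apply/lambda0P => n; rewrite (_ : nrm n 0 = cst 0); first exact: cvg_cst.
  by apply/funext => i; rewrite /nrm [X in Normc.normc X](_ : _ = 0)// normc0 mulr0.
move=> c x y /lambda0P xA /lambda0P yA; apply/lambda0P => n.
apply: (@squeeze_cvgr _ _ _ _ (cst 0)
  (fun i => Normc.normc c * nrm n x i + nrm n y i)).
- by apply: nearW => i /=; rewrite nrm_ge0 -nrmZ nrmD.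
- exact: cvg_cst.
- rewrite -[X in _ --> X](addr0 (0 : R)) -[X in _ --> X + _](mulr0 (Normc.normc c)).
  by apply: cvgD => //; apply: cvgMr.
Qed.

HB.instance Definition _ :=
  GRing.isSubmodClosed.Build _ _ lambda0_pred lambda0_submod_closed.
HB.instance Definition _ := [SubChoice_isSubLmodule of lambda0 by <:].

Definition kothe_seminorm (n : nat) (x : lambda0) : R :=
  sup (range (fun i => A n i * Normc.normc (x i))).

Let has_sup_nrm n (x : lambda0) : has_sup (range (nrm n x)).
Proof.
split; first by exists (nrm n x 0), 0%N.
have /lambda0P/(_ n) xA := valP x.
have /cvg_seq_bounded[M [_ /(_ (M + 1))]] := cvgP _ xA.
rewrite ltrDl ltr01 => /(_ isT) H.
by exists (M + 1) => _ [i _ <-]; rewrite (le_trans (ler_norm _))// H.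
Qed.

Let nrm_le n (x : lambda0) i : nrm n x i <= kothe_seminorm n x.
Proof. by apply: (sup_upper_bound (has_sup_nrm n x)); exists i. Qed.

Let seminorm_le n (x : lambda0) M :
  (forall i, nrm n x i <= M) -> kothe_seminorm n x <= M.
Proof.
move=> H; apply: ge_sup; first by have [] := has_sup_nrm n x.
by move=> _ [i _ <-]; exact: H.
Qed.

Lemma kothe_seminorm_ge0 n x : 0 <= kothe_seminorm n x.
Proof. exact: le_trans (nrm_ge0 n x 0) (nrm_le n x 0). Qed.

Lemma kothe_seminormD n x y :
  kothe_seminorm n (x + y) <= kothe_seminorm n x + kothe_seminorm n y.
Proof.
by apply: seminorm_le => i; rewrite (le_trans (nrmD _ _ _ _))// lerD ?nrm_le.
Qed.

Lemma kothe_seminormZ_le n c x :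
  kothe_seminorm n (c *: x) <= Normc.normc c * kothe_seminorm n x.
Proof. by apply: seminorm_le => i; rewrite nrmZ ler_wpM2l ?nrm_le. Qed.

Lemma kothe_seminormN n x : kothe_seminorm n (- x) = kothe_seminorm n x.
Proof.
suff H y : kothe_seminorm n (- y) <= kothe_seminorm n y.
  by apply/eqP; rewrite eq_le H -{1}(opprK x) H.
by apply: seminorm_le => i; rewrite /nrm normcN nrm_le.
Qed.

Lemma kothe_seminorm_mono m n x : (m <= n)%N ->
  kothe_seminorm m x <= kothe_seminorm n x.
Proof.
move=> /subnKC <-; elim: (n - m)%N => [|k IH]; first by rewrite addn0.
apply: (le_trans IH); rewrite addnS; apply: seminorm_le => i.
by rewrite (le_trans _ (nrm_le _ _ i))// /nrm ler_wpM2r ?kothe_mono.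
Qed.

Lemma kothe_seminorm0 n : kothe_seminorm n 0 = 0.
Proof.
apply/eqP; rewrite eq_le kothe_seminorm_ge0 andbT; apply: seminorm_le => i.
by rewrite /nrm [X in Normc.normc X](_ : _ = 0)// normc0 mulr0.
Qed.

(* The locally convex topology defined by the seminorms [kothe_seminorm n]. *)
Definition lambda0_entourage : set_system (lambda0 * lambda0) :=
  [set P | exists n (e : R), 0 < e /\
    [set xy | kothe_seminorm n (xy.1 - xy.2) < e] `<=` P].

Let ent_filter : Filter lambda0_entourage.
Proof.
split.
- by exists 0%N, 1.
- move=> P Q [n [e [e0 nP]]] [m [d [d0 mQ]]].
  exists (maxn n m), (Num.min e d); split; first by rewrite lt_min e0.
  move=> xy /=; rewrite lt_min => /andP[xe xd]; split.
    by apply/nP/(le_lt_trans _ xe)/kothe_seminorm_mono/leq_maxl.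
  by apply/mQ/(le_lt_trans _ xd)/kothe_seminorm_mono/leq_maxr.
- by move=> P Q PQ [n [e [e0 nP]]]; exists n, e; split=> // xy /nP/PQ.
Qed.

Let ent_diag P : lambda0_entourage P -> diagonal `<=` P.
Proof.
by move=> [n [e [e0 nP]]] xy /= xyE; apply: nP; rewrite /= xyE subrr kothe_seminorm0.
Qed.

Let ent_inv P : lambda0_entourage P -> lambda0_entourage P^-1%relation.
Proof.
move=> [n [e [e0 nP]]]; exists n, e; split => // -[x y] /= xy; apply: nP => /=.
by rewrite -opprB kothe_seminormN.
Qed.

Let ent_split P : lambda0_entourage P ->
  exists2 Q, lambda0_entourage Q & (Q \; Q)%relation `<=` P.
Proof.
move=> [n [e [e0 nP]]].
exists [set xy | kothe_seminorm n (xy.1 - xy.2) < e / 2].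
  by exists n, (e / 2); split => //; rewrite divr_gt0.
move=> -[x y] /= [z /= xz zy]; apply: nP => /=.
rewrite (_ : x - y = (x - z) + (z - y)); last by rewrite addrA subrK.
by rewrite (le_lt_trans (kothe_seminormD _ _ _))// [ltRHS]splitr ltrD.
Qed.

HB.instance Definition _ := @isUniform.Build lambda0 lambda0_entourage
  ent_filter ent_diag ent_inv ent_split.

Lemma nbhs_lambda0P (x : lambda0) (P : set lambda0) :
  nbhs x P <-> exists n (e : R), 0 < e /\
    [set y | kothe_seminorm n (x - y) < e] `<=` P.
Proof.
rewrite -nbhs_entourageE; split.
- move=> [Q [n [e [e0 nQ]]] QP]; exists n, e; split => // y xy.
  by apply: QP; apply/xsectionP/nQ.
- move=> [n [e [e0 nP]]].
  exists [set xy | kothe_seminorm n (xy.1 - xy.2) < e].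
    by exists n, e; split.
  by move=> y /xsectionP/nP.
Qed.

Let ballI n (e : R) (x : lambda0) : 0 < e ->
  nbhs x [set y | kothe_seminorm n (x - y) < e].
Proof. by move=> e0; apply/nbhs_lambda0P; exists n, e; split. Qed.

Let lambda0_add_continuous : continuous (fun x : lambda0 * lambda0 => x.1 + x.2).
Proof.
move=> [x y] P /= /nbhs_lambda0P[n [e [e0 nP]]].
exists ([set z | kothe_seminorm n (x - z) < e / 2],
        [set z | kothe_seminorm n (y - z) < e / 2]).
  by split; apply: ballI; rewrite divr_gt0.
move=> -[z t] /= [xz yt]; apply: nP => /=.
rewrite opprD addrACA.
by rewrite (le_lt_trans (kothe_seminormD _ _ _))// [ltRHS]splitr ltrD.
Qed.

Let lambda0_scale_continuous :
  continuous (fun z : C^o * lambda0 => z.1 *: z.2).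
Proof.
move=> [c x] P /= /nbhs_lambda0P[n [e [e0 nP]]].
pose M := kothe_seminorm n x + 1.
have M0 : 0 < M by rewrite ltr_wpDl// kothe_seminorm_ge0.
pose N := Normc.normc c + 1.
have N0 : 0 < N by rewrite ltr_wpDl.
pose d := Num.min 1 (e / 2 / M).
have d0 : 0 < d by rewrite lt_min ltr01 !divr_gt0.
exists ([set b : C^o | `|c - b| < d%:C],
        [set z | kothe_seminorm n (x - z) < e / 2 / N]).
  split => /=; last by apply: ballI; rewrite !divr_gt0.
  by apply: (@nbhsx_ballx _ C^o); rewrite ltcR.
move=> -[b z] /= []; rewrite normCE ltcR => cb xz; apply: nP => /=.
rewrite (_ : c *: x - b *: z = (c - b) *: x + b *: (x - z)); last first.
  by rewrite scalerBl scalerBr addrA subrK.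
rewrite (le_lt_trans (kothe_seminormD _ _ _))// [ltRHS]splitr ltr_leD//.
- rewrite (le_lt_trans (kothe_seminormZ_le _ _ _))//.
  apply: (@le_lt_trans _ _ (e / 2 / M * kothe_seminorm n x)).
    rewrite ler_wpM2r ?kothe_seminorm_ge0// ltW// (lt_le_trans cb)//.
    by rewrite ge_min lexx orbT.
  rewrite -mulrA -[ltRHS]mulr1 ltr_pM2l ?divr_gt0// mulrC ltr_pdivrMr// mul1r.
  by rewrite ltrDl.
- rewrite (le_trans (kothe_seminormZ_le _ _ _))//.
  apply: (@le_trans _ _ (N * (e / 2 / N))).
    rewrite ler_pM ?kothe_seminorm_ge0//; last exact: ltW.
    rewrite (_ : b = c + - (c - b)); last by rewrite opprB addrC subrK.
    rewrite (le_trans (le_normcD _ _))// lerD// normcN ltW// (lt_le_trans cb)//.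
    by rewrite ge_min lexx.
  by rewrite mulrC divfK// gt_eqF.
Qed.

Let lambda0_locally_convex : exists2 B : set_system lambda0,
  (forall b, b \in B -> convex_set b) & basis B.
Proof.
exists [set B | exists n x (e : R), B = [set y | kothe_seminorm n (x - y) < e]].
  move=> _ /set_mem[n [x [e ->]]] y z l /set_mem/= xy /set_mem/= xz.
  apply/mem_set => /=.
  have [t [s [t0 s0 ts lt ls]]] : exists t s : R,
      [/\ 0 <= t, 0 <= s, t + s = 1, Normc.normc (l%:num : C) = t
        & Normc.normc (1 - l%:num : C) = s].
    exists (Normc.normc (l%:num : C)), (Normc.normc (1 - l%:num : C)).
    split => //; apply: (@complexI R).
    by rewrite rmorphD /= -!normCE !ger0_norm ?subr_ge0// addrC subrK.
  rewrite (_ : x - _ = (l%:num : C) *: (x - y) + (1 - l%:num : C) *: (x - z)).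
    rewrite (le_lt_trans (kothe_seminormD _ _ _))//.
    apply: (@le_lt_trans _ _
      (t * kothe_seminorm n (x - y) + s * kothe_seminorm n (x - z))).
      by rewrite lerD// (le_trans (kothe_seminormZ_le _ _ _))// ?lt ?ls.
    rewrite -[ltRHS]mul1r -ts mulrDl.
    move: t0; rewrite le_eqVlt => /predU1P[t0|t0].
      move: ts; rewrite -t0 add0r => ->.
      by rewrite !mul0r !add0r !mul1r.
    by rewrite ltr_leD// ?ltr_pM2l// ler_wpM2l// ltW.
  rewrite !scalerBr addrACA -scalerDl.
  by rewrite [X in X *: x](_ : _ = 1) ?scale1r -?opprD // addrC subrK.
split.
  move=> _ [n [x [e ->]]]; rewrite openE => y /= xy.
  apply/nbhs_lambda0P; exists n, (e - kothe_seminorm n (x - y)).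
  rewrite subr_gt0; split => // z /= yz.
  rewrite (_ : x - z = (x - y) + (y - z)); last by rewrite addrA subrK.
  by rewrite (le_lt_trans (kothe_seminormD _ _ _))// -ltrBrDl.
move=> x P /nbhs_lambda0P[n [e [e0 nP]]].
exists [set y | kothe_seminorm n (x - y) < e] => //; split.
  by exists n, x, e.
by rewrite /= subrr kothe_seminorm0.
Qed.

HB.instance Definition _ :=
  PreTopologicalNmodule_isTopologicalNmodule.Build lambda0 lambda0_add_continuous.
HB.instance Definition _ :=
  TopologicalNmodule_isTopologicalLmodule.Build C lambda0 lambda0_scale_continuous.
HB.instance Definition _ :=
  Uniform_isTvs.Build C lambda0 lambda0_locally_convex.

Record G1_space : Prop := G1Space {
  G1_1 : forall n i, 0 < A n i.+1 <= A n i;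
  G1_2 : forall n, exists m, (n < m)%N /\
           exists c : R, 0 < c /\ forall i, A n i <= c * A m i ^+ 2 }.

Definition cesaro_seq (x : nat -> C) : nat -> C :=
  fun i => i.+1%:R^-1 * \sum_(j < i.+1) x j.

Section Cesaro.
Hypothesis hA : G1_space.

Let G1_mono n i j : (i <= j)%N -> A n j <= A n i.
Proof.
move=> /subnKC <-; elim: (j - i)%N => [|k IH]; first by rewrite addn0.
by rewrite addnS (le_trans _ IH)//; have /andP[] := G1_1 hA n (i + k).
Qed.

Let nrm_cesaro n x i :
  nrm n (cesaro_seq x) i <= i.+1%:R^-1 * \sum_(j < i.+1) nrm n x j.
Proof.
rewrite /nrm /cesaro_seq Normc.normcM mulrCA.
have -> : Normc.normc (i.+1%:R^-1 : C) = i.+1%:R^-1.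
  by apply: (@complexI R); rewrite -normCE fmorphV rmorph_nat ger0_norm.
rewrite ler_wpM2l// (@le_trans _ _ (A n i * \sum_(j < i.+1) Normc.normc (x j)))//.
  rewrite ler_wpM2l ?kothe_ge0//.
  elim/big_ind2 : _ => [|a b c d ab cd|//]; first by rewrite normc0.
  by rewrite (le_trans (le_normcD _ _))// lerD.
rewrite mulr_sumr ler_sum// => j _.
by rewrite ler_wpM2r// G1_mono// -ltnS.
Qed.

Lemma cesaro_subproof (x : lambda0) : cesaro_seq x \in lambda0_pred.
Proof.
have /lambda0P xA := valP x; apply/lambda0P => n.
apply: (@squeeze_cvgr _ _ _ _ (cst 0) (arithmetic_mean (nrm n x))).
- apply: nearW => i /=; rewrite nrm_ge0 (le_trans (nrm_cesaro _ _ _))//.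
  by rewrite /arithmetic_mean /series /= big_mkord.
- exact: cvg_cst.
- exact: (cesaro (xA n)).
Qed.

Definition cesaro_fun (x : lambda0) : lambda0 := Lambda0 (cesaro_subproof x).

Let cesaro_is_linear : linear cesaro_fun.
Proof.
move=> c x y; apply/val_inj/funext => i.
change (i.+1%:R^-1 * (\sum_(j < i.+1) (c * x j + y j)) =
  c * (i.+1%:R^-1 * \sum_(j < i.+1) x j) + i.+1%:R^-1 * \sum_(j < i.+1) y j).
by rewrite big_split /= -mulr_sumr mulrDr mulrCA.
Qed.

HB.instance Definition _ :=
  GRing.isLinear.Build C lambda0 lambda0 _ cesaro_fun cesaro_is_linear.

Lemma cesaro_continuous : continuous cesaro_fun.
Proof.
move=> x P /= /nbhs_lambda0P[n [e [e0 nP]]].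
apply/nbhs_lambda0P; exists n, e; split=> // y /= xy; apply: nP => /=.
rewrite -linearB (le_lt_trans _ xy)//; apply: seminorm_le => i.
rewrite (le_trans (nrm_cesaro _ _ _))// ler_pdivrMl//.
apply: le_trans (ler_sum _ (fun (j : 'I_i.+1) _ => nrm_le n (x - y) j)) _.
by rewrite sumr_const card_ord mulr_natl.
Qed.

Definition cesaro_operator : continuous_operator lambda0 :=
  ContinuousOperator cesaro_continuous.

End Cesaro.

End KotheEchelon.

(* Main.v *)
(* A nuclear map T is absolutely summing: sum_i |T x_i| is bounded by a constant
   times sup_{|t_i| <= 1} |sum_i t_i x_i|. Applied to x_i = e_i / a_m(i) in the
   local Banach spaces, this shows that for every n some m makes
   sum_i a_n(i) / a_m(i) finite; as a_m is bounded and a_n is decreasing,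
   i a_n(i) is bounded, and iterating (G1-2) gives: for all n, k there is m with
   i^k a_n(i) = O(a_m(i)). Hence polynomial factors are harmless in lambda_0(A).
   In particular the sequence of binomial coefficients x_i = binom(i, k), which
   satisfies C x = x / (k + 1), lies in lambda_0(A). For every other l (l = 0
   included) the equation l x - C x = y has a unique solution, found by a
   first-order recursion on the partial sums of x, and these partial sums grow
   at most polynomially relative to y. *)
Require Import Defs.
From HB Require Import structures.
From mathcomp Require Import all_boot all_order all_algebra.
From mathcomp Require Import complex ring zify.
From mathcomp Require Import all_classical all_reals all_analysis.

Import Order.TTheory GRing.Theory Num.Theory.
Import numFieldNormedType.Exports.

Set Implicit Arguments.
Unset Strict Implicit.
Unset Printing Implicit Defensive.

Local Open Scope classical_set_scope.
Local Open Scope ring_scope.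
Local Open Scope complex_scope.

(** * Nuclear maps are absolutely summing *)

(** The order of a [numFieldType] is only partial; the two realness assumptions make the negation of
    l <= b usable. *)
Lemma real_cvg_le (K : numFieldType) (u : nat -> K^o) (l b : K) :
  u @ \oo --> (l : K^o) -> l \is Num.real -> b \is Num.real ->
  (forall k, u k <= b) -> l <= b.
Proof.
move=> /cvgrPdist_lt ul lR bR ub; rewrite real_leNgt//; apply/negP => bl.
have /ul : 0 < l - b by rewrite subr_gt0.
move=> [N _ /(_ N (leqnn _)) /=].
have uR : u N \is Num.real by rewrite -(ger_real (ub N)).
rewrite real_ltNge ?normr_real ?realB//; move/negP; apply.
by rewrite (le_trans _ (real_ler_norm _)) ?realB// lerD2l lerN2.
Qed.

(** Expand each T x_i by the nuclear representation and exchange the sums: every functional [f k],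
    being of norm at most 1, contributes at most c, and the coefficients are summable with bound
    B. *)
Lemma nuclear_map_summing (K : numFieldType) (X Y : normedModType K)
    (T : {linear X -> Y}) : nuclear_map T ->
  exists2 B : K, 0 <= B & forall N (x : nat -> X) (c : K),
    (forall t : nat -> K, (forall i, `|t i| <= 1) ->
       `|\sum_(i < N) t i *: x i| <= c) ->
    \sum_(i < N) `|T (x i)| <= B * c.
Proof.
move=> [a [f [y [/cvg_seq_bounded a_bnd f1 y1 Ty]]]].
have [B [B0 aB]] : exists B : K, 0 <= B /\
    forall k, \sum_(j < k) `|a j| <= B.
  case: a_bnd => M [MR /(_ (M + 1))].
  rewrite ltrDl ltr01 => /(_ isT) H.
  have H' k : \sum_(j < k) `|a j| <= M + 1.
    have := H k I; rewrite /series /= big_mkord ger0_norm ?sumr_ge0//.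
  by exists (M + 1); split=> //; apply: le_trans (H' 0%N); rewrite big_ord0.
exists B => // N x c xc.
have c0 : 0 <= c.
  by apply: le_trans (xc (fun=> 0) _) => // i; rewrite normr0.
have fx k : \sum_(i < N) `|f k (x i)| <= c.
  (* These inverse phases turn [f k] of the combination into a sum of moduli; where [f k (x i)]
     vanishes, division by zero gives t_i = 0, which is harmless. *)
  pose t i := `|f k (x i)| / f k (x i).
  have /xc tc : forall i, `|t i| <= 1.
    move=> i; rewrite /t normf_div normr_id.
    have [->|h] := eqVneq (f k (x i)) 0; first by rewrite normr0 mul0r.
    by rewrite divff// normr_eq0.
  have := le_trans (f1 k _) tc; rewrite linear_sum /=.
  rewrite (eq_bigr (fun i : 'I_N => `|f k (x i)|)); last first.
    move=> i _; rewrite linearZ /= /t /GRing.scale/=.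
    have [->|h] := eqVneq (f k (x i)) 0; first by rewrite normr0 mulr0.
    by rewrite divfK.
  by rewrite ger0_norm// sumr_ge0.
apply: (@real_cvg_le _ (fun k => \sum_(i < N)
   `|series (fun k => (a k * f k (x i)) *: y k) k|)).
- apply: cvg_big => [|i _]; first exact: add_continuous.
  by apply: cvg_norm; exact: Ty.
- by rewrite ger0_real// sumr_ge0.
- by rewrite ger0_real// mulr_ge0.
move=> k; apply: (@le_trans _ _
  (\sum_(i < N) \sum_(j < k) `|a j| * `|f j (x i)|)).
  apply: ler_sum => i _; rewrite /series /= big_mkord.
  apply: (le_trans (ler_norm_sum _ _ _)); apply: ler_sum => j _.
  by rewrite normrZ normrM ler_piMr// mulr_ge0.
rewrite exchange_big /= (le_trans _ (ler_wpM2r c0 (aB k)))// mulr_suml.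
by apply: ler_sum => j _; rewrite -mulr_sumr ler_wpM2l.
Qed.

(** * Coordinates, seminorms and unit vectors of the echelon space *)

Section Lambda0.
Variables (R : realType) (A : kothe_matrix R).
Local Notation C := R[i].
Implicit Types (x y : lambda0 A) (n m i j : nat).

Lemma normcE_norm (z : C) : `|z| = (Normc.normc z)%:C. Proof. by []. Qed.

Lemma normc_ge0 (z : C) : 0 <= Normc.normc z.
Proof. by case: z => a b; exact: sqrtr_ge0. Qed.

Lemma normc_gt0 (z : C) : z != 0 -> 0 < Normc.normc z.
Proof.
move=> z0; rewrite lt_def normc_ge0 andbT; apply: contra z0 => /eqP.
by move=> /Normc.eq0_normc ->.
Qed.

Lemma normc_natr (n : nat) : Normc.normc (n%:R : C) = n%:R.
Proof.
by apply: (@complexI R); rewrite -normcE_norm normr_nat rmorph_nat.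
Qed.

Lemma normc_real (r : R) : 0 <= r -> Normc.normc r%:C = r.
Proof. by move=> r0; rewrite /= expr0n addr0 sqrtr_sqr ger0_norm. Qed.

(** Trades the complex limit for a real one, where squeezing arguments apply. *)
Lemma lambda0_predP (x : nat -> C) : x \in lambda0_pred A <->
  forall n, (fun i => A n i * Normc.normc (x i)) @ \oo --> (0 : R).
Proof.
have E n i : `|(A n i)%:C * x i| = (A n i * Normc.normc (x i))%:C.
  by rewrite normcE_norm Normc.normcM normc_real ?kothe_ge0.
split=> [/set_mem xA n|xA].
  apply/cvgrPdist_lt => e e0; have e0' : (0 : C) < e%:C by rewrite ltcR.
  have /cvgrPdist_lt/(_ _ e0') := xA n; apply: filterS => i.
  rewrite !sub0r !normrN E ltcR ger0_norm//.
  by rewrite mulr_ge0 ?kothe_ge0 ?normc_ge0.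
apply/mem_set => n; apply/cvgrPdist_lt => e e0.
have [r er] := complex_realP _ (gtr0_real e0).
have r0 : 0 < r by move: e0; rewrite er ltcR.
have /cvgrPdist_lt/(_ _ r0) := xA n; apply: filterS => i.
rewrite !sub0r !normrN E er ltcR ger0_norm//.
by rewrite mulr_ge0 ?kothe_ge0 ?normc_ge0.
Qed.

Lemma le_kothe_seminorm n x i :
  A n i * Normc.normc (x i) <= kothe_seminorm n x.
Proof.
apply: ub_le_sup; last by exists i.
have /lambda0_predP/(_ n) xA := valP x.
have /cvg_seq_bounded[M [_ /(_ (M + 1))]] := cvgP _ xA.
rewrite ltrDl ltr01 => /(_ isT) H.
by exists (M + 1) => _ [j _ <-]; rewrite (le_trans (ler_norm _))// H.
Qed.

Lemma kothe_seminorm_le n x (M : R) :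
  (forall i, A n i * Normc.normc (x i) <= M) -> kothe_seminorm n x <= M.
Proof.
move=> H; apply: ge_sup; first by exists (A n 0 * Normc.normc (x 0)), 0%N.
by move=> _ [i _ <-]; exact: H.
Qed.

Lemma kothe_seminormZ n (c : C) x :
  kothe_seminorm n (c *: x) = Normc.normc c * kothe_seminorm n x.
Proof.
apply/eqP; rewrite eq_le kothe_seminormZ_le/=.
have [->|c0] := eqVneq c 0.
  by rewrite Normc.normc0 mul0r kothe_seminorm_ge0.
rewrite -ler_pdivlMl ?normc_gt0// -Normc.normcV -{1}(scalerK c0 x).
exact: kothe_seminormZ_le.
Qed.

(** The cast is there because seminorms take values in the scalar field; continuity is the reverse
    triangle inequality. *)
Lemma continuous_kothe_seminorm n :
  continuous_seminorm (fun x : lambda0 A => (kothe_seminorm n x)%:C).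
Proof.
split; first split.
- by move=> x y; rewrite -rmorphD lecR kothe_seminormD.
- by move=> c x; rewrite kothe_seminormZ rmorphM.
move=> x; apply/(@cvgrPdist_lt _ C^o _ _ (nbhs_filter x)) => e e0.
have [r er] := complex_realP _ (gtr0_real e0).
have r0 : 0 < r by move: e0; rewrite er ltcR.
apply/nbhs_lambda0P; exists n, r; split=> // y /= xy.
rewrite -rmorphB er normcE_norm ltcR (le_lt_trans _ xy)//.
rewrite /= expr0n addr0 sqrtr_sqr ler_norml; apply/andP; split.
  rewrite lerNl opprB lerBlDr.
  rewrite (_ : kothe_seminorm n y = kothe_seminorm n (- (x - y) + x)).
    by rewrite -(kothe_seminormN n (x - y)) kothe_seminormD.
  by rewrite opprB subrK.
by rewrite lerBlDr -{1}(subrK y x) kothe_seminormD.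
Qed.

Lemma delta_subproof i : (fun j => (j == i)%:R : C) \in lambda0_pred A.
Proof.
apply/lambda0_predP => n; apply: cvg_near_cst.
exists i.+1 => // j /= ij.
by rewrite normc_natr gtn_eqF// mulr0.
Qed.

Definition delta i : lambda0 A := Lambda0 (delta_subproof i).

Lemma sum_deltaE (t : nat -> C) N j :
  (\sum_(i < N) t i *: delta i) j = if (j < N)%N then t j else 0.
Proof.
have -> : (\sum_(i < N) t i *: delta i) j = \sum_(i < N) t i * (j == i)%:R.
  elim/big_ind2 : _ => // u a v b <- <- //.
case: ifPn => jN.
  rewrite (bigD1 (Ordinal jN))//= eqxx mulr1 big1 ?addr0// => k.
  by rewrite -val_eqE /= eq_sym => /negPf ->; rewrite mulr0.
rewrite big1// => k _; case: eqP => [jk|]; last by rewrite mulr0.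
by move: jN; rewrite jk ltn_ord.
Qed.

End Lambda0.

(* Grothendieck-Pietsch criterion, necessity. *)
Lemma nuclear_kothe_sum (R : realType) (A : kothe_matrix R) :
  (forall n i, 0 < A n i) -> nuclear_space (lambda0 A) ->
  forall n, exists m, exists B : R, forall N, \sum_(i < N) A n i / A m i <= B.
Proof.
move=> A0 nucA n.
have [q [[[_ qZ] qc] _ [Ep [Eq [ip [iq [[ipE _] [iqE _] [T [_ TE nT]]]]]]]]] :=
  nucA _ (continuous_kothe_seminorm A n).
have [B B0 TB] := nuclear_map_summing nT.
have q0 : q 0 = 0 by rewrite -(scale0r (0 : lambda0 A)) qZ normr0 mul0r.
have [m [e [e0 me]]] : exists m (e : R), 0 < e /\
    forall y, kothe_seminorm m y < e -> q y < 1.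
  have /(@cvgrPdist_lt _ R[i]^o _ _ (nbhs_filter (0 : lambda0 A))) := qc 0.
  move=> /(_ 1 ltr01)/nbhs_lambda0P[m [e [e0 me]]].
  exists m, e; split=> // y ye; have := me y; rewrite /= q0 !sub0r.
  by rewrite kothe_seminormN normrN => /(_ ye); rewrite -iqE normr_id.
(* [me] asks for a strict inequality, so vectors of seminorm at most 1 are scaled by e/2 instead of
   e. *)
have e2 : 0 < e / 2 by rewrite divr_gt0.
have e2' := ltW e2.
have Am0 i : 0 <= (A m i)^-1 by rewrite invr_ge0 ltW.
pose w i := ((A m i)^-1%:C : R[i]) *: delta A i.
have H N : forall t : nat -> R[i], (forall i, `|t i| <= 1) ->
    `|\sum_(i < N) t i *: iq (w i)| <= ((e / 2)^-1)%:C.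
  move=> t t1; set v := (X in `|X|).
  pose s i := t i * (A m i)^-1%:C.
  have -> : v = iq (\sum_(i < N) s i *: delta A i).
    rewrite linear_sum; apply: eq_bigr => i _.
    by rewrite -scalerA [RHS]linearZ_LR.
  rewrite iqE; set z := (X in q X).
  have zm : kothe_seminorm m z <= 1.
    apply: (@kothe_seminorm_le _ _ m z) => i; rewrite sum_deltaE.
    case: ifP => _; last by rewrite Normc.normc0 mulr0.
    rewrite Normc.normcM mulrCA normc_real// divff ?gt_eqF//.
    by have := t1 i; rewrite mulr1 normcE_norm -(rmorph1 (real_complex R)) lecR.
  have : q ((e / 2)%:C *: z) < 1.
    apply: me; rewrite kothe_seminormZ normc_real//.
    rewrite (@le_lt_trans _ _ (e / 2))// ?ler_piMr//.
    by rewrite ltr_pdivrMr// ltr_pMr// ltr1n.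
  rewrite qZ normcE_norm normc_real// => qz.
  by rewrite fmorphV -[leRHS]mul1r ler_pdivlMr ?ltcR// mulrC ltW.
(* The summing constant lives in the complex field; being nonnegative, it comes from a real
   number. *)
have Br : B * ((e / 2)^-1)%:C \is Num.real.
  by rewrite ger0_real// mulr_ge0// ler0c invr_ge0.
have [B' BE] := complex_realP _ Br.
exists m, B' => N; rewrite -lecR -BE.
apply: le_trans (TB N (fun i => iq (w i)) _ (H N)); rewrite rmorph_sum.
apply: ler_sum => i _; rewrite /= TE ipE lecR kothe_seminormZ.
(* Coordinate i alone shows that the n-th seminorm of [delta A i] is at least a_n(i). *)
rewrite normc_real// mulrC ler_wpM2l//.
have := @le_kothe_seminorm _ _ n (delta A i) i.
by rewrite /= eqxx Normc.normc1 mulr1.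
Qed.

Lemma lambda0_linear_continuous (R : realType) (A : kothe_matrix R)
    (f : {linear lambda0 A -> lambda0 A}) :
  (forall n, exists m, exists2 K : R, 0 <= K &
     forall x, kothe_seminorm n (f x) <= K * kothe_seminorm m x) ->
  continuous f.
Proof.
move=> fK x P /nbhs_lambda0P[n [e [e0 nP]]].
have [m [K K0 nmK]] := fK n; have K1 : 0 < K + 1 by rewrite ltr_wpDl.
apply/nbhs_lambda0P; exists m, (e / (K + 1)); split; first exact: divr_gt0.
move=> y /=; rewrite ltr_pdivlMr// => xy; apply: nP => /=.
rewrite -linearB (le_lt_trans (nmK _))// (le_lt_trans _ xy)// mulrC.
by rewrite ler_wpM2l ?kothe_seminorm_ge0 ?lerDl.
Qed.

(** * Polynomial weights in a nuclear G_1-space *)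

Section G1.
Variables (R : realType) (A : kothe_matrix R) (A_G1 : G1_space A).
Local Notation C := R[i].

Lemma G1_gt0 n i : 0 < A n i.
Proof.
by have /andP[] := G1_1 A_G1 n i; exact: lt_le_trans.
Qed.

Lemma G1_decr n i j : (i <= j)%N -> A n j <= A n i.
Proof.
move=> /subnKC <-; elim: (j - i)%N => [|k IH]; first by rewrite addn0.
by rewrite addnS (le_trans _ IH)//; have /andP[] := G1_1 A_G1 n (i + k).
Qed.

Hypothesis A_nuclear : nuclear_space (lambda0 A).

(** By monotonicity each of the first i + 1 terms a_n(j) / a_m(j) of the bounded sum is at least
    a_n(i) / a_m(0). *)
Lemma G1_nuclear_decay n : exists2 B : R, 0 <= B &
  forall i, i.+1%:R * A n i <= B.
Proof.
have [m [B AB]] := nuclear_kothe_sum G1_gt0 A_nuclear n.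
have AB' i : i.+1%:R * A n i <= B * A m 0.
  rewrite -ler_pdivrMr ?G1_gt0// (le_trans _ (AB i.+1))//.
  rewrite -mulrA mulr_natl -[leLHS]/(_ *+ i.+1) -[X in _ *+ X]card_ord.
  rewrite -sumr_const.
  apply: ler_sum => j _; apply: ler_pM.
  - exact: kothe_ge0.
  - by rewrite invr_ge0 kothe_ge0.
  - by apply: G1_decr; rewrite -ltnS.
  - by rewrite lef_pV2 ?posrE ?G1_gt0// G1_decr.
exists (B * A m 0) => //; apply: le_trans (AB' 0%N).
by rewrite mulr_ge0 ?kothe_ge0.
Qed.

(** Induction on k: after a_n <= c a_m^2, one factor a_m absorbs a single i + 1 by the decay bound,
    and the other absorbs (i + 1)^k by the induction hypothesis. *)
Lemma G1_nuclear_weight n k : exists m, exists2 M : R, 0 <= M &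
  forall i, i.+1%:R ^+ k * A n i <= M * A m i.
Proof.
elim: k n => [|k IH] n.
  by exists n, 1 => // i; rewrite expr0.
have [m [_ [c [c0 nmc]]]] := G1_2 A_G1 n.
have [B B0 mB] := G1_nuclear_decay m.
have [l [M M0 mlM]] := IH m.
exists l, (c * B * M); first by rewrite !mulr_ge0// ltW.
move=> i; have i0 : 0 <= i.+1%:R ^+ k :> R by rewrite exprn_ge0.
apply: le_trans (_ : i.+1%:R ^+ k.+1 * (c * A m i ^+ 2) <= _).
  by rewrite ler_wpM2l// exprn_ge0.
rewrite (_ : _ * _ =
  c * (i.+1%:R * A m i) * (i.+1%:R ^+ k * A m i)); last first.
  by rewrite exprS; ring.
rewrite -[leRHS]mulrA; apply: ler_pM => //.
- by rewrite !mulr_ge0 ?kothe_ge0// ltW.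
- by rewrite mulr_ge0 ?kothe_ge0.
- by rewrite ler_wpM2l// ltW.
Qed.

(** The case k = 1 of the weight bound upgrades boundedness for a_m to decay O(1/i) for a_n. *)
Lemma lambda0_bounded (x : nat -> C) :
  (forall n, exists M : R, forall i, A n i * Normc.normc (x i) <= M) ->
  x \in lambda0_pred A.
Proof.
move=> xM; apply/lambda0_predP => n.
have [m [M M0 nmM]] := G1_nuclear_weight n 1.
have [B mB] := xM m.
apply: (@squeeze_cvgr _ _ _ _ (cst 0) (fun i => M * B * harmonic i)).
- apply: nearW => i /=; rewrite mulr_ge0 ?kothe_ge0 ?normc_ge0//=.
  rewrite ler_pdivlMr// mulrC mulrA -[i.+1%:R]expr1.
  apply: (le_trans (ler_wpM2r (normc_ge0 _) (nmM i))).
  by rewrite -mulrA ler_wpM2l.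
- exact: cvg_cst.
- rewrite -[X in _ --> X](mulr0 (M * B)).
  by apply: cvgMl_tmp; exact: cvg_harmonic.
Qed.

(** * Binomial eigenvectors *)

Lemma bin_le_exp i k : ('C(i, k) <= i.+1 ^ k)%N.
Proof.
elim: k => [|k IH]; first by rewrite bin0.
apply: leq_trans (_ : k.+1 * 'C(i, k.+1) <= _)%N; first by rewrite leq_pmull.
by rewrite mul_bin_left expnS leq_mul// (leq_trans (leq_subr _ _)).
Qed.

Lemma sum_bin i k : (\sum_(j < i) 'C(j, k))%N = 'C(i, k.+1).
Proof.
elim: i => [|i IH]; first by rewrite big_ord0.
by rewrite big_ord_recr /= IH binS addnC.
Qed.

(** The hockey-stick identity sums the column to binom(i + 1, k + 1), and (i + 1) binom(i, k) = (k +
    1) binom(i + 1, k + 1). *)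
Lemma cesaro_binomial i k :
  cesaro_seq (fun j => 'C(j, k)%:R : C) i = k.+1%:R^-1 * 'C(i, k)%:R.
Proof.
rewrite /cesaro_seq -natr_sum sum_bin; apply: (@mulfI _ i.+1%:R).
  by rewrite pnatr_eq0.
rewrite mulVKf ?pnatr_eq0// mulrCA -natrM mul_bin_diag natrM mulKf//.
Qed.

Lemma binomial_subproof k : (fun j => 'C(j, k)%:R : C) \in lambda0_pred A.
Proof.
apply: lambda0_bounded => n.
have [m [M M0 nmM]] := G1_nuclear_weight n k.
exists (M * A m 0) => i; rewrite normc_natr.
apply: (@le_trans _ _ (M * A m i)); last by rewrite ler_wpM2l// G1_decr.
apply: le_trans (nmM i); rewrite mulrC ler_wpM2r ?kothe_ge0//.
by rewrite -natrX ler_nat bin_le_exp.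
Qed.

Lemma cesaro_eigenvalue k :
  spectrum (cesaro_operator A_G1) (k.+1%:R^-1 : C).
Proof.
move=> [S [SK _]]; pose x := Lambda0 (binomial_subproof k).
have x0 : x = 0.
  rewrite -(SK x) [X in S X](_ : _ = 0) ?linear0//.
  apply/val_inj/funext => i.
  change (k.+1%:R^-1 * ('C(i, k)%:R : C) -
    cesaro_seq (fun j => 'C(j, k)%:R : C) i = 0).
  by rewrite cesaro_binomial subrr.
(* An inverse forces the eigenvector to vanish, yet its coordinate [k] is binom(k, k) = 1. *)
have : x k = 0 by rewrite x0.
by move/eqP; rewrite /= binn oner_eq0.
Qed.

End G1.

(** Bernoulli's inequality multiplied by (i + 1)^D; it lets the weight (i + 1)^D absorb one step of
    the recursion for the partial sums. *)
Lemma bernoulli_step (R : realType) (D i : nat) :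
  (1 + D%:R / i.+1%:R) * i.+1%:R ^+ D <= i.+2%:R ^+ D :> R.
Proof.
have -> : (i.+2%:R : R) = (1 + i.+1%:R^-1) * i.+1%:R.
  by rewrite mulrDl mulVf// mul1r -natr1 addrC.
rewrite exprMn ler_wpM2r ?exprn_ge0//.
elim: D => [|D IH]; first by rewrite mul0r addr0 expr0.
have h : 0 <= 1 + i.+1%:R^-1 :> R by rewrite addr_ge0.
rewrite exprS; apply: le_trans (ler_wpM2l h IH).
rewrite [leRHS](_ : _ = 1 + D.+1%:R / i.+1%:R + D%:R / i.+1%:R ^+ 2).
  by rewrite lerDl divr_ge0// exprn_ge0.
by rewrite expr2 invfM; ring.
Qed.

(** * The resolvent at a point l outside the set of all 1/k *)

Section Resolvent.
Variables (R : realType) (l : R[i]).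
Local Notation C := R[i].
Hypothesis l_neq : forall k : nat, l != k.+1%:R^-1.

Let d i : C := i.+1%:R * l - 1.

Let d_neq0 i : d i != 0.
Proof.
apply: contra (l_neq i); rewrite subr_eq0 => /eqP h; apply/eqP.
by apply: (@mulfI _ i.+1%:R); rewrite ?h ?mulfV ?pnatr_eq0.
Qed.

Let normd_gt0 i : 0 < Normc.normc (d i).
Proof. exact: normc_gt0. Qed.

Let normd_ge i : i.+1%:R * Normc.normc l - 1 <= Normc.normc (d i).
Proof.
rewrite lerBlDr -(normc_natr R) -Normc.normcM.
have {1}-> : i.+1%:R * l = d i + 1 by rewrite subrK.
by rewrite (le_trans (le_normcD _ _))// Normc.normc1.
Qed.

(** For l nonzero, |d_i| is never 0 and grows linearly, so i + 1 <= D |d_i| for some D; both claims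
    follow from it and (i + 1)|l| <= |d_i| + 1. For l = 0, |d_i| = 1. *)
Let d_growth : exists D : nat, forall i,
  i.+1%:R * Normc.normc l <= (1 + D%:R / i.+1%:R) * Normc.normc (d i) /\
  1 <= D%:R * Normc.normc (d i).
Proof.
have [l0|l_n0] := eqVneq l 0.
  exists 1%N => i; rewrite /d l0 mulr0 sub0r normcN Normc.normc0 mulr0.
  by rewrite Normc.normc1 !mulr1; split=> //; rewrite addr_ge0// divr_ge0.
have nl0 := normc_gt0 l_n0.
suff [D dD] : exists D : nat, forall i, i.+1%:R <= D%:R * Normc.normc (d i).
  exists D => i; split; last by rewrite (le_trans _ (dD i))// ler1n.
  rewrite mulrDl mul1r -(subrK 1 (_ * Normc.normc l)) lerD//.
  by rewrite mulrAC ler_pdivlMr// mul1r.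
(* For i >= N one has (i + 1)|l| >= 2, hence |d_i| >= (i + 1)|l| / 2; the finitely many earlier
   ratios are bounded by their sum [D0]. *)
pose N := Num.bound (2 / Normc.normc l).
have hN : 2 / Normc.normc l < N%:R by rewrite archi_boundP// divr_ge0// ltW.
pose D0 := \sum_(j < N) j.+1%:R / Normc.normc (d j).
have D00 : 0 <= D0 by apply: sumr_ge0 => j _; rewrite divr_ge0 ?normc_ge0.
have c0 : 0 <= 2 / Normc.normc l by rewrite divr_ge0// ltW.
exists (Num.bound (2 / Normc.normc l + D0)) => i; rewrite -ler_pdivrMr//.
apply: le_trans (ltW (archi_boundP (addr_ge0 c0 D00))).
have [iN|iN] := ltnP i N.
  rewrite ler_wpDl// /D0 (bigD1 (Ordinal iN))//= lerDl.
  by apply: sumr_ge0 => j _; rewrite divr_ge0 ?normc_ge0.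
rewrite ler_wpDr// ler_pdivrMr// mulrAC ler_pdivlMr//.
rewrite -ler_pdivrMl// (le_trans _ (normd_ge i))// lerBrDl -lerBrDr.
rewrite (_ : _ - _ = i.+1%:R * Normc.normc l / 2); last by field.
rewrite ler_pdivlMr// mul1r -ler_pdivrMr// (le_trans (ltW hN))//.
by rewrite ler_nat ltnW.
Qed.

(* With s_i the sum of the first i terms of x, l x - C x = y reads
   s_(i+1) = (i + 1) (l s_i + y_i) / ((i + 1) l - 1). *)
Fixpoint resolvent_psum (y : nat -> C) (i : nat) : C :=
  if i is j.+1 then j.+1%:R * (l * resolvent_psum y j + y j) / d j else 0.

Definition resolvent_seq (y : nat -> C) (i : nat) : C :=
  resolvent_psum y i.+1 - resolvent_psum y i.

Lemma sum_resolvent_seq y i :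
  \sum_(j < i) resolvent_seq y j = resolvent_psum y i.
Proof.
elim: i => [|i IH]; first by rewrite big_ord0.
by rewrite big_ord_recr IH /= /resolvent_seq addrC subrK.
Qed.

Lemma resolvent_seqK y i :
  l * resolvent_seq y i - cesaro_seq (resolvent_seq y) i = y i.
Proof.
rewrite /cesaro_seq sum_resolvent_seq /resolvent_seq /=.
set s := resolvent_psum y i.
have := d_neq0 i; rewrite /d => di; field.
by rewrite -mulrS di pnatr_eq0.
Qed.

(** The system is lower triangular with nonzero diagonal entries l - 1/(i + 1). *)
Lemma resolvent_inj (x : nat -> C) :
  (forall i, l * x i - cesaro_seq x i = 0) -> forall i, x i = 0.
Proof.
move=> xl; suff x0 i : forall j, (j < i)%N -> x j = 0.
  by move=> i; exact: (x0 i.+1).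
elim: i => // i IH j; rewrite ltnS leq_eqVlt => /predU1P[->|/IH//].
have := xl i; rewrite /cesaro_seq big_ord_recr big1 /=; last first.
  by move=> k _; exact: IH.
rewrite add0r -mulrBl => /eqP; rewrite mulf_eq0 subr_eq0 (negPf (l_neq i)).
by move=> /eqP.
Qed.

(** A discrete Gronwall estimate: each step multiplies the old sum by at most 1 + D/(i + 1), and
    these factors accumulate to at most (i + 1)^D. *)
Let resolvent_psum_le D (y : nat -> C) i :
  (forall i,
    i.+1%:R * Normc.normc l <= (1 + D%:R / i.+1%:R) * Normc.normc (d i) /\
    1 <= D%:R * Normc.normc (d i)) ->
  Normc.normc (resolvent_psum y i) <=
    i.+1%:R ^+ D * \sum_(j < i) D%:R * j.+1%:R * Normc.normc (y j).
Proof.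
move=> dD; elim: i => [|i IH].
  by rewrite big_ord0 mulr0 -[resolvent_psum y 0]/(0 : C) Normc.normc0.
have [h1 h2] := dD i.
rewrite big_ord_recr mulrDr /=; set s := resolvent_psum y i in IH *.
rewrite mulrDr mulrDl (le_trans (le_normcD _ _))//; apply: lerD.
  rewrite !Normc.normcM Normc.normcV normc_natr ler_pdivrMr//.
  rewrite mulrA (le_trans (ler_wpM2r (normc_ge0 _) h1))//.
  rewrite mulrAC ler_wpM2r ?normc_ge0//.
  apply: le_trans (_ : (1 + D%:R / i.+1%:R) *
    (i.+1%:R ^+ D * \sum_(j < i) D%:R * j.+1%:R * Normc.normc (y j)) <= _).
    by rewrite ler_wpM2l// addr_ge0// divr_ge0.
  rewrite mulrA ler_wpM2r ?bernoulli_step//.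
  by apply: sumr_ge0 => j _; rewrite !mulr_ge0 ?normc_ge0.
(* The new term: 1 <= D |d_i| pays for the division by d_i, and (i + 2)^D >= 1. *)
rewrite !Normc.normcM Normc.normcV normc_natr ler_pdivrMr//.
apply: (@le_trans _ _
  (D%:R * i.+1%:R * Normc.normc (y i) * Normc.normc (d i))).
  rewrite [leRHS](_ : _ =
    D%:R * Normc.normc (d i) * (i.+1%:R * Normc.normc (y i))); last by ring.
  by rewrite ler_peMl// mulr_ge0 ?normc_ge0.
rewrite ler_wpM2r ?normc_ge0// ler_peMl ?mulr_ge0 ?normc_ge0//.
by rewrite exprn_ege1// ler1n.
Qed.

Variables (A : kothe_matrix R) (A_G1 : G1_space A).
Hypothesis A_nuclear : nuclear_space (lambda0 A).

(** The exponent D + 2 collects D from the Gronwall factor, one from the weights j + 1 and one from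
    the number of summands. It does not depend on m, so m can be chosen afterwards. *)
Let resolvent_seq_poly : exists k, exists2 K : R, 0 <= K &
  forall m (y : lambda0 A) i, A m i * Normc.normc (resolvent_seq y i) <=
    i.+1%:R ^+ k * K * kothe_seminorm m y.
Proof.
have [D dD] := d_growth.
(* The range i <= j + 1 covers both partial sums whose difference is entry j, while all summands
   keep an index k <= j, so that a_m(j) <= a_m(k). *)
have psum m (y : lambda0 A) i j : (i <= j.+1)%N ->
    A m j * Normc.normc (resolvent_psum y i) <=
    i.+1%:R ^+ (D + 2) * D%:R * kothe_seminorm m y.
  move=> ij; apply: le_trans (ler_wpM2l (kothe_ge0 A m j)
    (resolvent_psum_le y i dD)) _.
  rewrite mulrCA exprD -!mulrA ler_wpM2l ?exprn_ge0// mulr_sumr.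
  apply: le_trans (_ : \sum_(k < i) i.+1%:R * (D%:R * kothe_seminorm m y) <= _).
    apply: ler_sum => k _.
    rewrite [leLHS](_ : _ =
      k.+1%:R * (D%:R * (A m j * Normc.normc (y k)))); last by ring.
    apply: ler_pM => //; first by rewrite !mulr_ge0 ?kothe_ge0 ?normc_ge0.
      by rewrite ler_nat (leq_trans (ltn_ord k)).
    rewrite ler_wpM2l// (le_trans _ (le_kothe_seminorm m y k))//.
    rewrite ler_wpM2r ?normc_ge0// (G1_decr A_G1)// -ltnS.
    exact: leq_trans ij.
  rewrite sumr_const card_ord -[leLHS]mulr_natl !mulrA.
  rewrite ler_wpM2r ?kothe_seminorm_ge0// ler_wpM2r// ler_wpM2r//.
  by rewrite ler_nat.
(* The power of 2 comes from i + 2 <= 2 (i + 1) in the later partial sum, the 1 from the earlier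
   one. *)
exists (D + 2)%N, ((2 ^+ (D + 2) + 1) * D%:R).
  by rewrite mulr_ge0// addr_ge0// exprn_ge0.
move=> m y i; rewrite /resolvent_seq.
apply: le_trans (ler_wpM2l (kothe_ge0 A m i) (le_normcD _ _)) _.
rewrite normcN mulrDr mulrA mulrDr mulrDl mulrDl mulr1; apply: lerD; last first.
  exact: psum.
apply: (le_trans (psum m y i.+1 i _)) => //.
rewrite ler_wpM2r ?kothe_seminorm_ge0// ler_wpM2r// -exprMn.
by rewrite lerXn2r ?nnegrE// -natrM ler_nat mulSn muln2; lia.
Qed.

Let resolvent_seq_bound n : exists m, exists2 K : R, 0 <= K &
  forall (y : lambda0 A) i,
    A n i * Normc.normc (resolvent_seq y i) <= K * kothe_seminorm m y.
Proof.
have [k [K K0 yK]] := resolvent_seq_poly.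
have [m [M M0 nmM]] := G1_nuclear_weight A_G1 A_nuclear n k.
exists m, (M * K); first exact: mulr_ge0.
move=> y i; have ik : 0 < i.+1%:R ^+ k :> R by rewrite exprn_gt0.
rewrite -(ler_pM2l ik) mulrA.
apply: le_trans (ler_wpM2r (normc_ge0 _) (nmM i)) _.
rewrite -[leLHS]mulrA (le_trans (ler_wpM2l M0 (yK _ _ _)))//.
by rewrite le_eqVlt; apply/orP; left; apply/eqP; ring.
Qed.

Lemma resolvent_subproof (y : lambda0 A) : resolvent_seq y \in lambda0_pred A.
Proof.
apply: (lambda0_bounded A_G1 A_nuclear) => n.
by have [m [K _ yK]] := resolvent_seq_bound n; exists (K * kothe_seminorm m y).
Qed.

Definition resolvent_fun (y : lambda0 A) : lambda0 A :=
  Lambda0 (resolvent_subproof y).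

Let T := cesaro_operator A_G1.

Lemma resolvent_funK y : l *: resolvent_fun y - T (resolvent_fun y) = y.
Proof. by apply/val_inj/funext => i; exact: resolvent_seqK. Qed.

(** With the right-inverse identity this yields both the linearity of [resolvent_fun] and the
    left-inverse identity, with no computation on the recursion. *)
Lemma sub_cesaro_inj (x y : lambda0 A) : l *: x - T x = l *: y - T y -> x = y.
Proof.
move=> xy; apply/eqP; rewrite -subr_eq0; apply/eqP/val_inj/funext.
apply: resolvent_inj => i.
have : l *: (x - y) - T (x - y) = 0.
  by rewrite [T _]linearB scalerBr opprD addrACA -opprD xy subrr.
exact: (congr1 (fun z : lambda0 A => z i)).
Qed.

Lemma resolvent_fun_is_linear : linear resolvent_fun.
Proof.
move=> c x y; apply: sub_cesaro_inj; rewrite resolvent_funK [T _]linearP.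
rewrite scalerDr opprD addrACA scalerA [l * c]mulrC -scalerA -scalerBr.
by rewrite !resolvent_funK.
Qed.

HB.instance Definition _ :=
  GRing.isLinear.Build C (lambda0 A) (lambda0 A) _ resolvent_fun
    resolvent_fun_is_linear.

Lemma resolvent_fun_continuous : continuous resolvent_fun.
Proof.
apply: lambda0_linear_continuous => n.
have [m [K K0 yK]] := resolvent_seq_bound n.
by exists m, K => // y; apply: kothe_seminorm_le => i; exact: yK.
Qed.

Lemma cesaro_resolvent : resolvent_set T l.
Proof.
exists (ContinuousOperator resolvent_fun_continuous); split => x /=.
  by apply: sub_cesaro_inj; rewrite resolvent_funK.
exact: resolvent_funK.
Qed.

End Resolvent.

Theorem proposition8 (R : realType) (A : kothe_matrix R)
    (A_nuclear : nuclear_space (lambda0 A)) (A_G1 : G1_space A)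
    (A_lim : forall n : nat, A n @ \oo --> (0 : R)) :
  [set (k.+1%:R^-1 : R[i]) | k in [set: nat]] =
  spectrum (cesaro_operator A_G1).
Proof.
apply/seteqP; split => [_ [k _ <-]|l]; first exact: cesaro_eigenvalue.
apply: contra_notP => nl; apply: cesaro_resolvent => // k.
by apply/eqP => lk; apply: nl; exists k.
Qed.
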